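(* Let $n,d,N$ be positive integers with $d\le n/2$ and $N\le\binom{\lfloor\sqrt{nd/2}\rfloor}{d}$, and let $z\ge1$ be real. Let $\mathbf A$ be either $\mathbf A_{n,d}$ (uniform case) or $\bigcup_{k=1}^d\mathbf A_{n,k}$ (non-uniform case). Let $\mathbf X\subseteq\mathbf A$ be random, containing each $\mathbf e\in\mathbf A$ independently with its own probability $\varphi_{\mathbf e}\in[\varphi_{\min},1]$, where $$\varphi_{\min}=\min\left\{\frac{15nN\left(\log N+\frac45\frac{\log(2n^z)}{n}\right)}{\binom nd},1\right\}\ \text{(uniform)},\qquad \varphi_{\min}=\min\left\{\frac{13nN\left(\log N+\frac{12}{13}\frac{\log(2n^z)}{n}\right)}{\sum_{k=1}^d\binom nk},1\right\}\ \text{(non-uniform)}.$$ Let $\pi_{\mathrm{LB}}=\frac12\frac{n}{N^{1/d}}$ in the uniform case and $\pi_{\mathrm{LB}}=\frac1{2\sqrt2}\frac{n}{N^{1/d}}$ in the non-uniform case. Let $\mathcal U$ be the event that $$|\mathbf X|\ge 7.5\,nN\left(\log N+\frac45\frac{\log(2n^z)}{n}\right)\ \text{(uniform)},\qquad |\mathbf X|\ge 6.5\,nN\left(\log N+\frac{12}{13}\frac{\log(2n^z)}{n}\right)\ \text{(non-uniform)}$$ (the right-hand sides equal $\frac12\varphi_{\min}|\mathbf A|$ when the minimum defining $\varphi_{\min}$ is attained by its first argument), and suppose $\mathcal U$ has positive probability. Then, conditionally on $\mathcal U$, with probability at least $1-\frac{2}{3n^z}$, $$\pi^\star_{\mathbf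 X}\in[\pi_{\mathrm{LB}},\ \pi_{IC}],$$ where $\pi_{IC}$, the maximum vertex footprint of the IC-design partition of $\mathbf X$, satisfies $\frac{\pi_{IC}}{\pi_{\mathrm{LB}}}\le 8e$ in the uniform case and $\frac{\pi_{IC}}{\pi_{\mathrm{LB}}}\le 8\sqrt2\,e$ in the non-uniform case.
   Context: $[n]=\{1,\dots,n\}$, and $\mathbf A_{n,k}$ is the set of all $k$-element subsets of $[n]$. $\log$ is the natural logarithm. **Partitions and footprint.** For $\mathbf X\subseteq\mathbf A$ (a hyperedge set), an $N$-edge partitioning of $\mathbf X$ is a tuple $(\mathbf\Phi_1,\dots,\mathbf\Phi_N)$ of pairwise disjoint (possibly empty) sets with union $\mathbf X$. Put $\alpha(\mathbf\Phi_b)=\{i\in[n]:\exists\,\mathbf e\in\mathbf\Phi_b,\ i\in\mathbf e\}$. The maximum vertex footprint of the partitioning is $\max_{b\in[N]}|\alpha(\mathbf\Phi_b)|$, and $\pi^\star_{\mathbf X}$ is the minimum of this quantity over all $N$-edge partitionings of $\mathbf X$. **IC (interweaved-cliques) design** for $(n,d,N)$. Let $f=\max\{r\in\mathbb Z:\binom rd\le N\}$ (so $f\ge d$) and $N'=\binom fd$. Let $s=n/f$ if $f\mid n$ and $s=\lfloor n/(f+d)\rfloor+1$ otherwise (under the assumptions here, $fs\le n$). Let $\mathcal F_i=\{(i-1)s+1,\dots,is\}$ for $i\in[f]$; the vertices $fs+1,\dots,n$ lie in no family. For $\mathbf e\subseteq[n]$ let $\mathcal B(\mathbf e)=\{j\in[f]:\mathbf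 e\cap\mathcal F_j\ne\emptyset\}$. Step A. For each $k$ (only $k=d$ in the uniform case; $k=1,\dots,d$ in the non-uniform case), $\mathbf A_{n,k}$ is split into groups $\widetilde{\mathbf\Phi}^k_\sigma$ indexed by the $d$-subsets $\sigma$ of $[f]$, as follows. For each $\mathcal I\subseteq[f]$ with $|\mathcal I|\le k$, list $\mathbf Q^k_{\mathcal I}=\{\mathbf e\in\mathbf A_{n,k}:\mathcal B(\mathbf e)=\mathcal I\}$ in lexicographic order. List the $d$-subsets $\sigma\supseteq\mathcal I$ of $[f]$ in lexicographic order as $\sigma_1,\dots,\sigma_m$, with $m=\binom{f-|\mathcal I|}{d-|\mathcal I|}$. Write $|\mathbf Q^k_{\mathcal I}|=qm+r$ with $0\le r<m$. Cut the list of $\mathbf Q^k_{\mathcal I}$ into $m$ consecutive blocks, the first $r$ of size $q+1$ and the others of size $q$, and assign the $j$-th block to $\sigma_j$. $\widetilde{\mathbf\Phi}^k_\sigma$ is the union of all blocks assigned to $\sigma$ over all such $\mathcal I$. Step B. Order the $N'$ indices $\sigma$ lexicographically and rename the groups $\widetilde{\mathbf\Phi}^k_1,\dots,\widetilde{\mathbf\Phi}^k_{N'}$. Let $r=N\bmod N'$, and let $s_b=\lceil N/N'\rceil$ for $b\le r$ and $s_b=\lfloor N/N'\rfloor$ for $r<b\le N'$. Split the old group $\widetilde{\mathbf\Phi}^k_b$ into $s_b$ sub-parts numbered $0,\dots,s_b-1$ by going through it in lexicographic order in a round-robin manner. Sub-part $b'$ of old group $b$ becomes the new group with index $b+b'N'$.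 This gives $N$ groups $\widetilde{\mathbf\Phi}^k_1,\dots,\widetilde{\mathbf\Phi}^k_N$ for each $k$. Set $\widetilde{\mathbf\Phi}_b=\widetilde{\mathbf\Phi}^d_b$ in the uniform case and $\widetilde{\mathbf\Phi}_b=\bigcup_{k=1}^d\widetilde{\mathbf\Phi}^k_b$ in the non-uniform case; these partition $\mathbf A$. Step C. For $\mathbf X\subseteq\mathbf A$, the IC partition of $\mathbf X$ is $\mathbf\Phi_b=\widetilde{\mathbf\Phi}_b\cap\mathbf X$, $b\in[N]$, and $\pi_{IC}=\max_{b}|\alpha(\mathbf\Phi_b)|$.
   Formalization: The probability bound is stated only for N ≥ 2, since it fails for N = 1 (e.g. uniform, d = 1, n = 1000, z = 1, φ_e = 1 on 50 singletons and φ_min on the rest); the ratio bounds on π_IC/π_LB are stated for all N ≥ 1. *)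

(* Defs.v *)
From HB Require Import structures.
From mathcomp Require Import all_boot all_order all_algebra.
From mathcomp Require Import reals sequences exp.

Set Implicit Arguments.
Unset Strict Implicit.
Unset Printing Implicit Defensive.

Import Order.TTheory GRing.Theory Num.Theory.

(* The vertex set [n] is 'I_n and all indices are 0-based: vertex i, family j,
   group b here are vertex i + 1, family j + 1, group b + 1 when counting
   from 1. *)

Inductive edge_case := Uniform | NonUniform.

Definition kedges (n k : nat) : {set {set 'I_n}} :=
  [set e : {set 'I_n} | #|e| == k].

Definition all_edges (c : edge_case) (n d : nat) : {set {set 'I_n}} :=
  match c with
  | Uniform => kedges n d
  | NonUniform => \bigcup_(1 <= k < d.+1) kedges n k
  end.

Section Partitions.
Variables n N : nat.

Definition edge_partitioning (Phi : {ffun 'I_N -> {set {set 'I_n}}})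
    (X : {set {set 'I_n}}) : bool :=
  [forall b, forall b', (b != b') ==> [disjoint Phi b & Phi b']]
  && (\bigcup_b Phi b == X).

Definition footprint (E : {set {set 'I_n}}) : {set 'I_n} :=
  [set i | [exists e in E, i \in e]].

Definition max_footprint (Phi : {ffun 'I_N -> {set {set 'I_n}}}) : nat :=
  \max_(b < N) #|footprint (Phi b)|.

(* The neutral element n bounds every footprint, so this is the minimum as soon
   as a partitioning exists, i.e. when 0 < N. *)
Definition pi_star (X : {set {set 'I_n}}) : nat :=
  \big[minn/n]_(Phi : {ffun 'I_N -> {set {set 'I_n}}} | edge_partitioning Phi X)
    max_footprint Phi.

End Partitions.

(* Finite sets are compared through their increasing enumerations. *)
Definition lex_le (n : nat) (e1 e2 : {set 'I_n}) : bool :=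
  ((enum e1 : seqlexi 'I_n) <= (enum e2 : seqlexi 'I_n))%O.

Definition lex_list (n : nat) (E : {set {set 'I_n}}) : seq {set 'I_n} :=
  sort (@lex_le n) (enum E).

(* The j-th of m consecutive blocks of l, the first (size l %% m) blocks having
   size (size l %/ m).+1 and the others size (size l %/ m). *)
Definition block (T : Type) (l : seq T) (m j : nat) : seq T :=
  nth [::] (reshape [seq (size l %/ m + (i < size l %% m))%N | i <- iota 0 m] l)
      j.

(* max {r | 'C(r, d) <= N}; see ic_fP for the search bound. *)
Definition ic_f (d N : nat) : nat :=
  \max_(r < (N + d).+1 | 'C(r, d) <= N) r.

Lemma ic_fP (d N r : nat) : 0 < d -> ('C(r, d) <= N) = (r <= ic_f d N).
Proof.
case: d => // d _.
have bin_gt k : k < 'C(k + d.+1, d.+1).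
  elim: k => [|k IHk]; first by rewrite bin_gt0.
  rewrite addSn binS -addn1; apply: leq_add IHk _.
  by rewrite bin_gt0 (leq_trans (leqnSn d)) ?leq_addl.
apply/idP/idP => [le_rN|le_rf].
  have lt_r : r < (N + d.+1).+1.
    rewrite ltnNge; apply/negP => /ltnW /(leq_bin2l d.+1) le_bin.
    by have := leq_trans (bin_gt N) le_bin; rewrite ltnNge le_rN.
  exact: (@leq_bigmax_cond _ _ (fun i : 'I_(N + d.+1).+1 => i : nat)
            (Ordinal lt_r)).
apply: leq_trans (leq_bin2l d.+1 le_rf) _; rewrite /ic_f.
by elim/big_ind: _ => [|x y lex ley|//]; rewrite ?bin0n // /maxn; case: ifP.
Qed.

Section ICDesign.
Variables n d N : nat.

Let f := ic_f d N.
Let N' := 'C(f, d).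

Definition ic_s : nat := if f %| n then n %/ f else (n %/ (f + d)).+1.

Definition family (j : 'I_f) : {set 'I_n} :=
  [set i : 'I_n | j * ic_s <= i < j.+1 * ic_s].

Definition families_of (e : {set 'I_n}) : {set 'I_f} :=
  [set j | e :&: family j != set0].

Definition edges_on (k : nat) (I : {set 'I_f}) : {set {set 'I_n}} :=
  [set e in kedges n k | families_of e == I].

Definition dsets_above (I : {set 'I_f}) : seq {set 'I_f} :=
  lex_list [set sigma in kedges f d | I \subset sigma].

Definition stepA_group (k : nat) (sigma : {set 'I_f}) : {set {set 'I_n}} :=
  \bigcup_(I : {set 'I_f} | (#|I| <= k) && (I \subset sigma))
    [set e in block (lex_list (edges_on k I)) 'C(f - #|I|, d - #|I|)
                    (index sigma (dsets_above I))].

Definition old_group (k b : nat) : {set {set 'I_n}} :=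
  stepA_group k (nth set0 (lex_list (kedges f d)) b).

(* In the first branch N %% N' is positive, so that ceil(N / N') is
   (N %/ N').+1. *)
Definition nb_subparts (b : nat) : nat :=
  if b < N %% N' then (N %/ N').+1 else N %/ N'.

Definition subpart (k b b' : nat) : {set {set 'I_n}} :=
  [set e in old_group k b |
     index e (lex_list (old_group k b)) %% nb_subparts b == b'].

(* b0 + b' * N' with b0 < N' is the new index of sub-part b' of old group b0. *)
Definition new_group (k b : nat) : {set {set 'I_n}} :=
  subpart k (b %% N') (b %/ N').

Definition ic_group (c : edge_case) (b : nat) : {set {set 'I_n}} :=
  match c with
  | Uniform => new_group d b
  | NonUniform => \bigcup_(1 <= k < d.+1) new_group k b
  end.

Definition ic_partition (c : edge_case) (X : {set {set 'I_n}}) :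
    {ffun 'I_N -> {set {set 'I_n}}} :=
  [ffun b : 'I_N => ic_group c b :&: X].

Definition pi_IC (c : edge_case) (X : {set {set 'I_n}}) : nat :=
  max_footprint (ic_partition c X).

End ICDesign.

Local Open Scope ring_scope.

Section RandomHypergraph.
Variables (R : realType) (n : nat).

(* The law of the random subset X of A containing each e in A independently
   with probability phi e, evaluated on the event E. *)
Definition Pr (A : {set {set 'I_n}}) (phi : {set 'I_n} -> R)
    (E : pred {set {set 'I_n}}) : R :=
  \sum_(X : {set {set 'I_n}} | (X \subset A) && E X)
    (\prod_(e in X) phi e) * (\prod_(e in A :\: X) (1 - phi e)).

Definition cond_Pr (A : {set {set 'I_n}}) (phi : {set 'I_n} -> R)
    (E U : pred {set {set 'I_n}}) : R :=
  Pr A phi [pred X | E X && U X] / Pr A phi U.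

End RandomHypergraph.

Section Bounds.
Variables (R : realType) (c : edge_case) (n d N : nat) (z : R).

Definition phi_min : R :=
  match c with
  | Uniform =>
      Num.min (15 * n%:R * N%:R
                 * (ln N%:R + 4 / 5 * (ln (2 * n%:R `^ z) / n%:R))
               / 'C(n, d)%:R) 1
  | NonUniform =>
      Num.min (13 * n%:R * N%:R
                 * (ln N%:R + 12 / 13 * (ln (2 * n%:R `^ z) / n%:R))
               / (\sum_(1 <= k < d.+1) 'C(n, k))%N%:R) 1
  end.

Definition pi_LB : R :=
  match c with
  | Uniform => 1 / 2 * (n%:R / N%:R `^ (1 / d%:R))
  | NonUniform => 1 / (2 * Num.sqrt 2) * (n%:R / N%:R `^ (1 / d%:R))
  end.

Definition many_edges (X : {set {set 'I_n}}) : bool :=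
  match c with
  | Uniform =>
      15 / 2 * n%:R * N%:R
        * (ln N%:R + 4 / 5 * (ln (2 * n%:R `^ z) / n%:R)) <= #|X|%:R
  | NonUniform =>
      13 / 2 * n%:R * N%:R
        * (ln N%:R + 12 / 13 * (ln (2 * n%:R `^ z) / n%:R)) <= #|X|%:R
  end.

Definition ratio_bound : R :=
  match c with
  | Uniform => 8 * expR 1
  | NonUniform => 8 * Num.sqrt 2 * expR 1
  end.

End Bounds.

(* Main.v *)
(* Upper bound: all edges of a group have their families inside one d-set sigma
   of families, so its footprint is made of the d families of sigma and of the
   few vertices outside all families; this is at most 4 n d / (f + 1), while
   N < 'C(f + 1, d) <= (e (f + 1) / d) ^ d.
   Lower bound: if every group has fewer than pi_LB vertices, then X lies in the
   set Y of edges contained in one of N fixed vertex sets of that size, and Y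
   misses at least a twelfth of all edges. The event that X is contained in Y has
   probability at most exp (- phi_min |A| / 12), which beats the 2 ^ (n N)
   choices of the N vertex sets. A Chernoff bound shows that the conditioning
   event has probability at least 3 / 4. *)

Require Import Defs.
From mathcomp Require Import all_boot all_order all_algebra.
From mathcomp Require Import reals sequences exp.
From mathcomp Require Import ring lra zify.

Set Implicit Arguments.
Unset Strict Implicit.
Unset Printing Implicit Defensive.

Import Order.TTheory GRing.Theory Num.Theory.

(** * The IC partition *)

Section LexList.
Variables (n : nat) (E : {set {set 'I_n}}).

Lemma mem_lex_list : lex_list E =i E.
Proof. by move=> e; rewrite mem_sort mem_enum. Qed.

Lemma uniq_lex_list : uniq (lex_list E).
Proof. by rewrite sort_uniq enum_uniq. Qed.

Lemma size_lex_list : size (lex_list E) = #|E|.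
Proof. by rewrite size_sort cardE. Qed.

End LexList.

Lemma flatten_block (T : Type) (l : seq T) (m : nat) : 0 < m ->
  flatten [seq block l m j | j <- iota 0 m] = l.
Proof.
move=> m_gt0; set sh := [seq (size l %/ m + (i < size l %% m))%N | i <- iota 0 m].
have size_sh : size sh = m by rewrite size_map size_iota.
have sum_sh : sumn sh = size l.
  rewrite /sh sumnE big_map big_split /= big_const_seq.
  rewrite count_predT size_iota iter_addn_0 [RHS](divn_eq _ m); congr addn.
  have le_rm : size l %% m <= m by rewrite ltnW ?ltn_mod.
  (* The first [size l %% m] indices contribute 1 each, all later ones 0. *)
  rewrite -[X in iota 0 X](subnKC le_rm) iotaD big_cat /= !big_seq.
  rewrite (eq_bigr (fun _ => 1%N)); last first.
    by move=> i; rewrite mem_iota /= add0n => ->.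
  rewrite [X in _ + X]big1; last first.
    by move=> i; rewrite mem_iota add0n => /andP[/leq_gtF ->].
  by rewrite -big_seq big_const_seq count_predT size_iota iter_addn_0 mul1n addn0.
rewrite -[RHS](@reshapeKr _ sh l) ?sum_sh //; congr flatten.
apply: (@eq_from_nth _ [::]); first by rewrite size_map size_iota size_reshape size_sh.
move=> i; rewrite size_map size_iota => lt_im.
by rewrite (nth_map 0) ?size_iota // nth_iota.
Qed.

Lemma mem_blockP (T : eqType) (l : seq T) (m : nat) (x : T) : 0 < m ->
  reflect (exists2 j, j < m & x \in block l m j) (x \in l).
Proof.
move=> m_gt0; rewrite -{2}(flatten_block l m_gt0).
apply: (iffP flatten_mapP) => [[j]|[j lt_jm x_j]].
  by rewrite mem_iota => /andP[_ lt_jm] x_j; exists j.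
by exists j; rewrite ?mem_iota.
Qed.

(** An entry lying in two pieces would occur twice in the concatenation. *)
Lemma uniq_flatten_nth (T : eqType) (s : seq (seq T)) (x : T) (i j : nat) :
  uniq (flatten s) -> x \in nth [::] s i -> x \in nth [::] s j -> i = j.
Proof.
elim: s i j => [|l s IHs] [|i] [|j] //=; rewrite cat_uniq => /and3P[_ /hasPn sep us].
- move=> xl xj; have lt_j : j < size s.
    by rewrite ltnNge; apply/negP => le_j; rewrite nth_default in xj.
  have /sep/negP[] // : x \in flatten s.
  by apply/flattenP; exists (nth [::] s j); rewrite ?mem_nth.
- move=> xi xl; have lt_i : i < size s.
    by rewrite ltnNge; apply/negP => le_i; rewrite nth_default in xi.
  have /sep/negP[] // : x \in flatten s.
  by apply/flattenP; exists (nth [::] s i); rewrite ?mem_nth.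
- by move=> xi xj; rewrite (IHs i j).
Qed.

Lemma block_inj (T : eqType) (l : seq T) (m i j : nat) (x : T) : 
  uniq l -> i < m -> j < m -> x \in block l m i -> x \in block l m j -> i = j.
Proof.
move=> ul lt_im lt_jm xi xj.
have m_gt0 : 0 < m by apply: leq_ltn_trans lt_im.
apply: (@uniq_flatten_nth _ [seq block l m j | j <- iota 0 m] x).
- by rewrite flatten_block.
- by rewrite (nth_map 0) ?size_iota // nth_iota.
- by rewrite (nth_map 0) ?size_iota // nth_iota.
Qed.

Lemma bigcup_natP (T : finType) (F : nat -> {set T}) (a b : nat) (x : T) :
  reflect (exists2 k, a <= k < b & x \in F k) (x \in \bigcup_(a <= k < b) F k).
Proof.
rewrite (big_morph (fun X : {set T} => x \in X) (id1 := false) (op1 := orb)).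
- rewrite big_has; apply: (iffP hasP) => [] [k k_range xFk]; exists k => //.
    by rewrite -mem_index_iota.
  by rewrite mem_index_iota.
- by move=> X Y; rewrite inE.
- by rewrite inE.
Qed.

(** Lets both cases be counted as a single range of edge sizes. *)
Definition min_size (c : edge_case) (d : nat) : nat :=
  if c is Uniform then d else 1.

Lemma in_all_edges (c : edge_case) (n d : nat) (e : {set 'I_n}) :
  (e \in all_edges c n d) = (min_size c d <= #|e| <= d).
Proof.
case: c => /=; first by rewrite inE eqn_leq andbC.
apply/bigcup_natP/idP => [[k k_range]|e_range]; first by rewrite inE => /eqP->.
by exists #|e|; rewrite ?inE.
Qed.

Lemma ic_f_ge (d N : nat) : 0 < d -> 0 < N -> d <= ic_f d N.
Proof. by move=> d_gt0 N_gt0; rewrite -ic_fP // binn. Qed.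

Lemma bin_ic_f_le (d N : nat) : 0 < d -> 'C(ic_f d N, d) <= N.
Proof. by move=> d_gt0; rewrite ic_fP. Qed.

Lemma bin_ic_f_gt0 (d N : nat) : 0 < d -> 0 < N -> 0 < 'C(ic_f d N, d).
Proof. by move=> d_gt0 N_gt0; rewrite bin_gt0 ic_f_ge. Qed.

(** Removing [I] is a bijection onto the subsets of its complement of size [d - #|I|]. Thus step A
    cuts as many blocks as there are d-sets to receive them. *)
Lemma size_dsets_above (d N : nat) (I : {set 'I_(ic_f d N)}) : #|I| <= d ->
  size (dsets_above I) = 'C(ic_f d N - #|I|, d - #|I|).
Proof.
move=> le_Id; rewrite size_lex_list.
have -> : ic_f d N - #|I| = #|~: I| by rewrite [RHS]cardsCs setCK card_ord.
rewrite -cards_draws.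
set D := [set A : {set _} | A \subset ~: I & _]; transitivity #|[set I :|: A | A in D]|.
  apply: eq_card => A; apply/idP/imsetP => [|[B]].
    rewrite !inE => /andP[/eqP cA sIA]; exists (A :\: I).
      by rewrite inE cardsD (setIidPr sIA) cA eqxx andbT subsetDr.
    by rewrite -{1}(setID A I) (setIidPr sIA).
  rewrite inE => /andP[sB /eqP cB] ->; rewrite !inE subsetUl andbT.
  rewrite cardsU disjoint_setI0 ?cards0 ?subn0 ?cB ?subnKC //.
  by rewrite disjoint_sym disjoints_subset.
apply: card_in_imset => A B; rewrite !inE => /andP[sA _] /andP[sB _] /= eqAB.
apply/setP => x; have /setP/(_ x) := eqAB; rewrite !inE.
move/subsetP/(_ x): sA; move/subsetP/(_ x): sB; rewrite !inE.
by case: (x \in I) => //= hB hA _; apply/idP/idP => [/hA|/hB].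
Qed.

Lemma bigminn_le (I : finType) (P : pred I) (F : I -> nat) (x0 : nat) (i : I) :
  P i -> \big[minn/x0]_(j | P j) F j <= F i.
Proof.
rewrite -big_filter => Pi; have : i \in filter P (index_enum I).
  by rewrite mem_filter Pi mem_index_enum.
elim: (filter _ _) => // j s IHs; rewrite inE big_cons geq_min.
by case/predU1P => [->|/IHs ->]; rewrite ?leqnn ?orbT.
Qed.

(** * The groups of the design and their footprints *)

Section Families.
Variables n d N : nat.

Lemma familyP (i : 'I_n) (j j' : 'I_(ic_f d N)) :
  i \in Defs.family n j -> i \in Defs.family n j' -> j = j'.
Proof.
rewrite !inE => /andP[le1 lt1] /andP[le2 lt2]; apply/val_inj/eqP => /=.
have lt21 := leq_ltn_trans le1 lt2; have lt12 := leq_ltn_trans le2 lt1.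
rewrite !ltn_mul2r in lt21 lt12; case/andP: lt12 => _ lt12.
by case/andP: lt21 => _ lt21; rewrite eqn_leq -ltnS lt21 -ltnS.
Qed.

(** The families are disjoint, so a vertex determines its family, and the families met by [e] are
    among the values of [h] on the vertices of [e]. *)
Lemma card_families_of (e : {set 'I_n}) : #|families_of d N e| <= #|e|.
Proof.
pose h (i : 'I_n) := [pick j : 'I_(ic_f d N) | i \in Defs.family n j].
rewrite -(card_imset _ (@Some_inj _)).
apply: leq_trans (leq_imset_card h e); apply/subset_leq_card/subsetP => x.
case/imsetP=> j; rewrite inE => /set0Pn[i /setIP[ie ij]] {x}->.
apply/imsetP; exists i => //; rewrite /h; case: pickP => [j' ij'|/(_ j)].
  by congr Some; apply: familyP ij ij'.
by rewrite ij.
Qed.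

Lemma index_dsets_above (I sigma : {set 'I_(ic_f d N)}) :
  I \subset sigma -> #|sigma| = d ->
  index sigma (dsets_above I) < 'C(ic_f d N - #|I|, d - #|I|).
Proof.
move=> sI card_sigma; rewrite -size_dsets_above ?index_mem.
  by rewrite mem_lex_list !inE card_sigma eqxx.
exact: leq_trans (subset_leq_card sI) (eq_leq card_sigma).
Qed.

(** An edge in a block cut from [edges_on n k I] meets exactly the families in [I], so the union
    over [I] collapses to one term. *)
Lemma stepA_groupP (k : nat) (sigma : {set 'I_(ic_f d N)}) (e : {set 'I_n}) :
  k <= d -> #|sigma| = d ->
  reflect (let I := families_of d N e in
    [/\ #|e| = k, I \subset sigma &
    e \in block (lex_list (edges_on n k I)) 'C(ic_f d N - #|I|, d - #|I|)
                (index sigma (dsets_above I))])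
  (e \in stepA_group n k sigma).
Proof.
move=> le_kd card_sigma; apply: (iffP bigcupP) => /= [[I /andP[le_Ik sI]]|[]].
  rewrite inE => e_blk; have lt_m := index_dsets_above sI card_sigma.
  have : e \in lex_list (edges_on n k I).
    apply/mem_blockP; first exact: leq_ltn_trans lt_m.
    by exists (index sigma (dsets_above I)).
  by rewrite mem_lex_list !inE => /andP[/eqP ek /eqP eI]; rewrite eI.
move=> ek sI e_blk; exists (families_of d N e); last by rewrite inE.
by rewrite sI andbT -ek card_families_of.
Qed.

Lemma stepA_group_exists (e : {set 'I_n}) : 0 < d -> 0 < N -> #|e| <= d ->
  exists2 sigma : {set 'I_(ic_f d N)}, #|sigma| = d & e \in stepA_group n #|e| sigma.
Proof.
move=> d_gt0 N_gt0 le_ed; set I := families_of d N e.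
have le_Id : #|I| <= d by apply: leq_trans (card_families_of e) le_ed.
have m_gt0 : 0 < 'C(ic_f d N - #|I|, d - #|I|).
  by rewrite bin_gt0 leq_sub2r // ic_f_ge.
have : e \in lex_list (edges_on n #|e| I) by rewrite mem_lex_list !inE !eqxx.
case/(mem_blockP _ _ m_gt0) => j lt_jm e_blk.
have lt_j : j < size (dsets_above I) by rewrite size_dsets_above.
have := mem_nth set0 lt_j; rewrite mem_lex_list !inE => /andP[/eqP card_s sI].
exists (nth set0 (dsets_above I) j) => //; apply/stepA_groupP => //; split=> //.
by rewrite index_uniq // uniq_lex_list.
Qed.

(** The position of [e] in its list fixes its block, and the block number fixes the d-set. *)
Lemma stepA_group_inj (k : nat) (sigma tau : {set 'I_(ic_f d N)}) (e : {set 'I_n}) :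
  k <= d -> #|sigma| = d -> #|tau| = d ->
  e \in stepA_group n k sigma -> e \in stepA_group n k tau -> sigma = tau.
Proof.
move=> le_kd cs ct /stepA_groupP[] // ek ss es /stepA_groupP[] // _ st et.
have in_dsets (u : {set 'I_(ic_f d N)}) : #|u| = d -> families_of d N e \subset u ->
    u \in dsets_above (families_of d N e).
  by rewrite mem_lex_list !inE => -> ->; rewrite eqxx.
suff eq_index : index sigma (dsets_above (families_of d N e)) =
                index tau (dsets_above (families_of d N e)).
  by rewrite -(nth_index set0 (in_dsets _ cs ss)) eq_index nth_index ?in_dsets.
apply: block_inj es et; rewrite ?uniq_lex_list //; exact: index_dsets_above.
Qed.

Let N' := 'C(ic_f d N, d).

Lemma card_nth_kedges (b : nat) : b < N' ->
  #|nth set0 (lex_list (kedges (ic_f d N) d)) b| = d.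
Proof.
move=> lt_b; have /(mem_nth set0) : b < size (lex_list (kedges (ic_f d N) d)).
  by rewrite size_lex_list card_draws card_ord.
by rewrite mem_lex_list inE => /eqP.
Qed.

Lemma old_group_inj (k b b' : nat) (e : {set 'I_n}) : k <= d -> b < N' -> b' < N' ->
  e \in old_group n d N k b -> e \in old_group n d N k b' -> b = b'.
Proof.
move=> le_kd lt_b lt_b' eb eb'; have size_l : size (lex_list (kedges (ic_f d N) d)) = N'.
  by rewrite size_lex_list card_draws card_ord.
apply/eqP; rewrite -(nth_uniq set0 _ _ (uniq_lex_list (kedges (ic_f d N) d))) ?size_l //.
by apply/eqP; apply: stepA_group_inj eb eb'; rewrite ?card_nth_kedges.
Qed.

Lemma old_group_exists (e : {set 'I_n}) : 0 < d -> 0 < N -> #|e| <= d ->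
  exists2 b, b < N' & e \in old_group n d N #|e| b.
Proof.
move=> d_gt0 N_gt0 le_ed; have [sigma cs es] := stepA_group_exists d_gt0 N_gt0 le_ed.
have sl : sigma \in lex_list (kedges (ic_f d N) d) by rewrite mem_lex_list inE cs.
exists (index sigma (lex_list (kedges (ic_f d N) d))); last by rewrite /old_group nth_index.
by move: sl; rewrite -index_mem size_lex_list card_draws card_ord.
Qed.

(** The old group containing [e] fixes [b %% N'], and the round-robin position of [e] in it fixes
    [b %/ N']. *)
Lemma new_group_inj (k b b' : nat) (e : {set 'I_n}) : 0 < d -> 0 < N -> k <= d ->
  e \in new_group n d N k b -> e \in new_group n d N k b' -> b = b'.
Proof.
move=> d_gt0 N_gt0 le_kd; rewrite !inE => /andP[eb /eqP sb] /andP[eb' /eqP sb'].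
have N'_gt0 : 0 < N' by apply: bin_ic_f_gt0.
have eq_mod : b %% N' = b' %% N' by apply: old_group_inj eb eb'; rewrite ?ltn_mod.
by rewrite (divn_eq b N') (divn_eq b' N') -sb -sb' eq_mod.
Qed.

Lemma new_group_exists (e : {set 'I_n}) : 0 < d -> 0 < N -> #|e| <= d ->
  exists2 b, b < N & e \in new_group n d N #|e| b.
Proof.
move=> d_gt0 N_gt0 le_ed; have [b0 lt_b0 eb0] := old_group_exists d_gt0 N_gt0 le_ed.
have N'_gt0 : 0 < N' by apply: bin_ic_f_gt0.
pose b1 := index e (lex_list (old_group n d N #|e| b0)) %% nb_subparts d N b0.
(* As [N' <= N], every old group has at least one sub-part. *)
have q_gt0 : 0 < N %/ N' by rewrite divn_gt0 // bin_ic_f_le.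
have lt_b1 : b1 < nb_subparts d N b0.
  by rewrite ltn_mod /nb_subparts -/N'; case: ifP.
exists (b1 * N' + b0).
  have {1}-> := divn_eq N N'; move: lt_b1; rewrite /nb_subparts -/N'.
  (* For [b0 < N %% N'] the sub-part number [b1] may reach [N %/ N']; the new index stays below [N]
     because [b0] is below the remainder. *)
  case: (ltnP b0 (N %% N')) => [lt_b0r|_] lt_b1.
    by rewrite -addnS; apply: leq_add => //; rewrite leq_mul2r -(ltnS b1) lt_b1 orbT.
  apply: (@leq_trans (b1.+1 * N')); first by rewrite mulSn addnC ltn_add2r.
  by rewrite (leq_trans _ (leq_addr _ _)) // leq_mul2r lt_b1 orbT.
have eq_mod : (b1 * N' + b0) %% N' = b0 by rewrite modnMDl modn_small.
have eq_div : (b1 * N' + b0) %/ N' = b1 by rewrite divnMDl // divn_small ?addn0.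
by rewrite /new_group -/N' eq_mod eq_div inE eb0 eqxx.
Qed.

Lemma new_group_size (k b : nat) (e : {set 'I_n}) : 0 < d -> 0 < N -> k <= d ->
  e \in new_group n d N k b -> #|e| = k.
Proof.
move=> d_gt0 N_gt0 le_kd; rewrite inE => /andP[/stepA_groupP[] //].
by rewrite card_nth_kedges // ltn_mod bin_ic_f_gt0.
Qed.

(** New groups of level [k] only contain edges of size [k], so in the non-uniform union only
    [k = #|e|] matters. *)
Lemma mem_ic_group (c : edge_case) (b : nat) (e : {set 'I_n}) : 0 < d -> 0 < N ->
  (e \in ic_group n d N c b) =
  (e \in all_edges c n d) && (e \in new_group n d N #|e| b).
Proof.
move=> d_gt0 N_gt0; rewrite in_all_edges; case: c => /=.
  apply/idP/andP => [eb|[]]; last by rewrite -eqn_leq => /eqP <-.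
  by have ed := new_group_size d_gt0 N_gt0 (leqnn d) eb; rewrite ed leqnn.
apply/bigcup_natP/andP => [[k k_range eb]|[e_range eb]]; last by exists #|e|.
have le_kd : k <= d by case/andP: k_range.
by rewrite (new_group_size d_gt0 N_gt0 le_kd eb).
Qed.

Lemma ic_partitionP (c : edge_case) (X : {set {set 'I_n}}) : 0 < d -> 0 < N ->
  X \subset all_edges c n d -> edge_partitioning (ic_partition d N c X) X.
Proof.
move=> d_gt0 N_gt0 sXA; apply/andP; split.
  apply/forallP => b; apply/forallP => b'; apply/implyP; apply: contraNT.
  case/pred0Pn => e /=; rewrite !ffunE !inE !mem_ic_group // in_all_edges.
  case/andP => /andP[/andP[/andP[_ le_ed] eb] _] /andP[/andP[_ eb'] _].
  by apply/eqP/val_inj; apply: new_group_inj eb eb'.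
apply/eqP/setP => e; apply/bigcupP/idP => [[b _]|eX].
  by rewrite ffunE inE => /andP[].
have eA := subsetP sXA e eX.
have := eA; rewrite in_all_edges => /andP[_ /(new_group_exists d_gt0 N_gt0)[b lt_b eb]].
by exists (Ordinal lt_b); rewrite // ffunE inE mem_ic_group // eA eb.
Qed.

Lemma pi_star_le_IC (c : edge_case) (X : {set {set 'I_n}}) : 0 < d -> 0 < N ->
  X \subset all_edges c n d -> pi_star N X <= pi_IC d N c X.
Proof.
move=> d_gt0 N_gt0 sXA.
by apply: (@bigminn_le _ _ (@max_footprint n N)); apply: ic_partitionP.
Qed.

Lemma card_ord_range (a b : nat) : #|[set i : 'I_n | a <= i < b]| <= b - a.
Proof.
rewrite cardE -(size_map val) -(size_iota a (b - a)) uniq_leq_size //.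
  by rewrite map_inj_uniq ?enum_uniq //; apply: val_inj.
move=> k /mapP[i]; rewrite mem_enum inE => i_range ->.
rewrite mem_iota; case/andP: i_range => le_a lt_b.
by rewrite le_a subnKC // ltnW // (leq_ltn_trans le_a).
Qed.

Lemma card_footprint_group (c : edge_case) (b : nat) : 0 < d -> 0 < N ->
  #|footprint (ic_group n d N c b)| <=
    d * ic_s n d N + (n - ic_f d N * ic_s n d N).
Proof.
move=> d_gt0 N_gt0; set s := ic_s n d N; set f := ic_f d N.
pose sigma := nth set0 (lex_list (kedges f d)) (b %% N').
have card_sigma : #|sigma| = d by rewrite card_nth_kedges // ltn_mod bin_ic_f_gt0.
have sub_s : footprint (ic_group n d N c b) \subset
    (\bigcup_(j in sigma) Defs.family n j) :|: [set i : 'I_n | f * s <= i < n].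
  apply/subsetP => i; rewrite !inE => /existsP[e /andP[]].
  rewrite mem_ic_group // in_all_edges => /andP[/andP[_ le_ed]].
  rewrite inE => /andP[/stepA_groupP[] // _ sI _ _] ie.
  rewrite ltn_ord andbT; case: leqP => [|lt_i]; first by rewrite orbT.
  have s_gt0 : 0 < s by case: (s) lt_i => //; rewrite muln0.
  (* A vertex below [f * s] lies in family [i %/ s]; since [e] meets that family, it belongs to
     [sigma]. *)
  have lt_j : i %/ s < f by rewrite ltn_divLR.
  rewrite orbF; apply/bigcupP; exists (Ordinal lt_j); last first.
    by rewrite inE /= -/s leq_trunc_div /= ltn_ceil.
  apply: (subsetP sI); rewrite inE; apply/set0Pn; exists i; rewrite inE ie inE /= -/s.
  by rewrite leq_trunc_div ltn_ceil.
apply: leq_trans (subset_leq_card sub_s) _; apply: leq_trans (leq_card_setU _ _) _.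
apply: leq_add; last exact: card_ord_range.
have -> : d * s = \sum_(j in sigma) s by rewrite sum_nat_const card_sigma.
elim/big_rec2: _ => [|j U V _ IH]; first by rewrite cards0.
apply: leq_trans (leq_card_setU _ _) _; apply: leq_add => //.
by apply: leq_trans (card_ord_range _ _) _; rewrite mulSn addnK.
Qed.

Lemma pi_IC_le (c : edge_case) (X : {set {set 'I_n}}) : 0 < d -> 0 < N ->
  pi_IC d N c X <= d * ic_s n d N + (n - ic_f d N * ic_s n d N).
Proof.
move=> d_gt0 N_gt0; apply/bigmax_leqP => b _; rewrite ffunE.
apply: leq_trans (card_footprint_group c b d_gt0 N_gt0).
apply/subset_leq_card/subsetP => i; rewrite !inE => /existsP[e].
by rewrite inE => /andP[/andP[eb _] ie]; apply/existsP; exists e; rewrite eb.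
Qed.

End Families.

(** * Random sub-hypergraphs *)

Local Open Scope ring_scope.

(** Each factor satisfies 1 - a <= 1 - p <= exp(-p). *)
Lemma expR_ge_prod1B (R : realType) (I : finType) (A : {set I}) (a : I -> R) (p : R) :
  (forall i, i \in A -> p <= a i <= 1) ->
  \prod_(i in A) (1 - a i) <= expR (- (p * #|A|%:R)).
Proof.
move=> a_range; rewrite mulr_natr -mulNrn -mulr_natr expRM_natr -prodr_const.
apply: ler_prod => i /a_range /andP[le_pa le_a1]; rewrite subr_ge0 le_a1 /=.
by apply: le_trans (expR_ge1Dx _); rewrite lerD2l lerN2.
Qed.

Section Law.
Variables (R : realType) (n : nat) (A : {set {set 'I_n}}) (phi : {set 'I_n} -> R).

(** Expanding the product over [A] gives one term per subset. This evaluates the total mass and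
    every expectation of a product over [X]. *)
Lemma sum_prod_subset (g h : {set 'I_n} -> R) :
  \sum_(X : {set {set 'I_n}} | X \subset A)
    (\prod_(e in X) g e) * (\prod_(e in A :\: X) h e) = \prod_(e in A) (g e + h e).
Proof.
(* With the values 0 and 1 outside [A], the expansion runs over all sets and those not inside [A]
   contribute nothing. *)
pose G e := if e \in A then g e else 0; pose H e := if e \in A then h e else 1.
transitivity (\prod_e (G e + H e)); last first.
  rewrite [RHS]big_mkcond; apply: eq_bigr => e _; rewrite /G /H.
  by case: ifP; rewrite ?add0r.
rewrite bigA_distr [RHS](bigID (fun X : {set {set 'I_n}} => X \subset A)) /=.
rewrite [X in _ + X]big1 ?addr0 => [|X /subsetPn[e eX eA]]; last first.
  by rewrite (bigD1 e) //= eX /G (negPf eA) mul0r.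
apply: eq_bigr => X sXA; rewrite [RHS](bigID (mem X)) /=; congr (_ * _).
  by apply: eq_bigr => e eX; rewrite eX /G (subsetP sXA).
rewrite [RHS]big_mkcond [LHS]big_mkcond; apply: eq_bigr => e _.
by rewrite inE; case: (e \in X) => //=; rewrite /H; case: ifP.
Qed.

Hypothesis phi_range : forall e, e \in A -> 0 <= phi e <= 1.

Let w (X : {set {set 'I_n}}) := (\prod_(e in X) phi e) * (\prod_(e in A :\: X) (1 - phi e)).

Let w_ge0 (X : {set {set 'I_n}}) : X \subset A -> 0 <= w X.
Proof.
move=> sXA; rewrite mulr_ge0 ?prodr_ge0 // => e.
  by move/(subsetP sXA)/phi_range/andP=> [].
by case/setDP => /phi_range /andP[_]; rewrite subr_ge0.
Qed.

(** Markov's argument: [F] dominates the indicator of [E], so its expectation dominates the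
    probability. *)
Lemma Pr_le_sum (E : pred {set {set 'I_n}}) (F : {set {set 'I_n}} -> R) :
  (forall X : {set {set 'I_n}}, X \subset A -> 0 <= F X) ->
  (forall X : {set {set 'I_n}}, X \subset A -> E X -> 1 <= F X) ->
  Pr A phi E <= \sum_(X : {set {set 'I_n}} | X \subset A) F X * w X.
Proof.
move=> F_ge0 F_ge1; rewrite /Pr [X in _ <= X](bigID E) /= -[X in X <= _]addr0.
apply: lerD; last by apply: sumr_ge0 => X /andP[sXA _]; rewrite mulr_ge0 ?w_ge0 ?F_ge0.
by apply: ler_sum => X /andP[sXA EX]; rewrite ler_peMl ?w_ge0 ?F_ge1.
Qed.

Lemma Pr_mono (E F : pred {set {set 'I_n}}) :
  (forall X : {set {set 'I_n}}, X \subset A -> E X -> F X) -> Pr A phi E <= Pr A phi F.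
Proof.
move=> sEF; rewrite /Pr [X in X <= _]big_mkcond [X in _ <= X]big_mkcond.
apply: ler_sum => X _; case sXA: (X \subset A) => //=.
by case EX: (E X); [rewrite sEF | case: ifP => // _; exact: w_ge0].
Qed.

Lemma PrT : Pr A phi predT = 1.
Proof.
rewrite /Pr (eq_bigl (fun X : {set {set 'I_n}} => X \subset A)) => [|X]; last by rewrite andbT.
by rewrite sum_prod_subset big1 // => e _; rewrite subrKC.
Qed.

Lemma Pr_split (E F : pred {set {set 'I_n}}) :
  Pr A phi F = Pr A phi [pred X | E X && F X] + Pr A phi [pred X | ~~ E X && F X].
Proof.
rewrite /Pr (bigID E) /=; congr (_ + _); apply: eq_bigl => X;
  by rewrite -andbA [F X && _]andbC.
Qed.

Lemma Pr_union (I : finType) (P : pred I) (E : pred {set {set 'I_n}})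
    (F : I -> pred {set {set 'I_n}}) :
  (forall X : {set {set 'I_n}}, X \subset A -> E X -> exists2 i, P i & F i X) ->
  Pr A phi E <= \sum_(i | P i) Pr A phi (F i).
Proof.
move=> cover.
apply: le_trans (Pr_le_sum (F := fun X : {set {set 'I_n}} => \sum_(i | P i) (F i X)%:R) _ _) _.
- by move=> X _; apply: sumr_ge0.
- move=> X sXA /(cover _ sXA)[i Pi FX]; rewrite (bigD1 i) //= FX.
  by rewrite lerDl sumr_ge0.
under eq_bigr do rewrite mulr_suml.
rewrite exchange_big /=; apply: ler_sum => i Pi; rewrite /Pr big_mkcondr /=.
by apply: ler_sum => X sXA; case: (F i X); rewrite ?mul1r ?mul0r.
Qed.

Lemma PrC (U : pred {set {set 'I_n}}) : Pr A phi U = 1 - Pr A phi [pred X | ~~ U X].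
Proof.
have h (E : pred {set {set 'I_n}}) : Pr A phi [pred X | E X && predT X] = Pr A phi E.
  by apply: eq_bigl => X; rewrite /= andbT.
by have := Pr_split U predT; rewrite PrT (h U) (h [pred X | ~~ U X]) => ->;
  rewrite addrK.
Qed.

(** Dropping [U] from the joint event bounds the conditional probability of failure by Pr(not E) /
    Pr(U). *)
Lemma cond_Pr_ge (E U : pred {set {set 'I_n}}) (q : R) :
  Pr A phi [pred X | ~~ E X] <= q * Pr A phi U -> 0 < Pr A phi U ->
  1 - q <= cond_Pr A phi E U.
Proof.
move=> badE U_gt0; rewrite /cond_Pr ler_pdivlMr // mulrBl mul1r {1}(Pr_split E U).
rewrite lerBlDr lerD2l; apply: le_trans badE.
by apply: Pr_mono => X _ /andP[].
Qed.

Variable p : R.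
Hypothesis phi_ge : forall e, e \in A -> p <= phi e.

Lemma Pr_subset_le (Y : {set {set 'I_n}}) :
  Pr A phi [pred X : {set {set 'I_n}} | X \subset Y] <= \prod_(e in A :\: Y) (1 - phi e).
Proof.
(* The indicator of [X \subset Y] is a product over [X], so its expectation factors: an edge of [Y]
   gives 1, any other edge 1 - phi. *)
pose F (X : {set {set 'I_n}}) : R := \prod_(e in X) (e \in Y)%:R.
apply: le_trans (Pr_le_sum (F := F) _ _) _.
- by move=> X _; apply: prodr_ge0.
- by move=> X _ /= sXY; rewrite /F big1 // => e eX; rewrite (subsetP sXY).
under [X in X <= _]eq_bigr do rewrite mulrA -big_split /=.
rewrite sum_prod_subset (bigID (mem Y)) /=.
rewrite big1 ?mul1r => [|e /andP[_ ->]]; last by rewrite mul1r subrKC.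
rewrite le_eqVlt; apply/predU1l.
rewrite [LHS]big_mkcond [RHS]big_mkcond; apply: eq_bigr => e _.
by rewrite !inE andbC; case: (e \in Y); rewrite //= mul0r add0r.
Qed.

(* Chernoff's bound, with the moment generating function taken at ln (3/4). *)
Lemma Pr_few_le (m : R) : m <= p * #|A|%:R -> p <= 1 ->
  Pr A phi [pred X : {set {set 'I_n}} | #|X|%:R < m / 2] <= expR (- (m / 12)).
Proof.
move=> le_m p_le1.
(* If [#|X| < m / 2] then exp(m / 6) exceeds exp(|X| / 3), and exp(1/3) * 3/4 >= 1 makes [F X] at
   least 1. *)
pose F (X : {set {set 'I_n}}) : R := expR (m / 6) * \prod_(e in X) (3 / 4).
apply: le_trans (Pr_le_sum (F := F) _ _) _.
- by move=> X _; rewrite mulr_ge0 ?expR_ge0 // prodr_ge0 // => _ _; lra.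
- move=> X _ /= lt_m; rewrite /F prodr_const.
  have h : 1 <= expR (1 / 3) * (3 / 4) :> R.
    by have := expR_ge1Dx (1 / 3 : R); lra.
  apply: le_trans (exprn_ege1 #|X| h) _; rewrite exprMn -expRM_natr.
  by apply: ler_wpM2r; [apply: exprn_ge0; lra | rewrite ler_expR; lra].
under eq_bigr do rewrite -mulrA [X in _ * X]mulrA -big_split /=.
rewrite -mulr_sumr sum_prod_subset.
have -> : - (m / 12) = m / 6 + - (m / 4) by lra.
rewrite expRD ler_wpM2l ?expR_ge0 //.
(* An edge contributes phi * 3/4 + (1 - phi) = 1 - phi / 4, whence the exponent - m / 4. *)
rewrite (eq_bigr (fun e => 1 - phi e / 4)) => [|e _]; last by lra.
apply: le_trans (@expR_ge_prod1B _ _ A (fun e => phi e / 4) (p / 4) _) _.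
  move=> e eA; have /andP[_ le1] := phi_range eA; have gep := phi_ge eA.
  by apply/andP; split; lra.
by rewrite ler_expR; lra.
Qed.

End Law.

(** * Counting edges inside a small vertex set *)

Section Binomials.
Local Open Scope nat_scope.

(** In falling factorials, (r - i) / (n - i) is at most r / n; here this is cross-multiplied. *)
Lemma bin_mul_expn_le (r n d : nat) : r <= n ->
  'C(r, d) * n ^ d <= 'C(n, d) * r ^ d.
Proof.
move=> le_rn; rewrite -(leq_pmul2r (fact_gt0 d)) mulnAC bin_ffact.
rewrite [leqRHS]mulnAC bin_ffact.
elim: d => [|d IHd] //; rewrite !ffactnSr !expnSr !(mulnACA _ (_ - _)).
apply: leq_mul IHd _; rewrite !mulnBl [n * r]mulnC leq_sub2l //.
by rewrite leq_mul2l le_rn orbT.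
Qed.

Lemma card_edges_in (c : edge_case) (n d : nat) (S : {set 'I_n}) :
  #|[set e in all_edges c n d | e \subset S]| =
    \sum_(min_size c d <= k < d.+1) 'C(#|S|, k).
Proof.
under eq_bigr do rewrite -cards_draws -sum1dep_card big_mkcond.
rewrite exchange_big -sum1_card big_mkcond; apply: eq_bigr => e _ /=.
rewrite inE in_all_edges; case: (e \subset S) => /=; last by rewrite andbF big1.
rewrite andbT -big_mkcond sum1_count (@eq_count _ _ (pred1 #|e|)) => [|k].
  by rewrite count_uniq_mem ?iota_uniq // mem_index_iota ltnS; case: ifP.
by rewrite /= eq_sym.
Qed.

Lemma card_all_edges (c : edge_case) (n d : nat) :
  #|all_edges c n d| = \sum_(min_size c d <= k < d.+1) 'C(n, k).
Proof.
rewrite -[in RHS](card_ord n) -cardsT -card_edges_in.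
by apply: eq_card => e; rewrite inE subsetT andbT.
Qed.

Lemma bin_le_sum (c : edge_case) (n d : nat) : 0 < d ->
  'C(n, d) <= \sum_(min_size c d <= k < d.+1) 'C(n, k).
Proof.
move=> d_gt0; rewrite big_nat_recr /= ?leq_addl //; case: c => //=.
Qed.

Lemma sum_bin_le_exp2 (c : edge_case) (r d : nat) :
  \sum_(min_size c d <= k < d.+1) 'C(r, k) <= 2 ^ r.
Proof.
rewrite -card_all_edges -[X in _ <= 2 ^ X]card_ord -cardsT -card_powerset.
by apply/subset_leq_card/subsetP => e _; rewrite inE subsetT.
Qed.

End Binomials.

(** * Numerical bounds on the share of edges inside [N] small sets *)

Section CoverNumerics.
Variable R : realType.

(** The value is chosen to give e / (2 sqrt 2) <= 97/100 in [cover_nonunif_large]. A lower bound for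
    1 / e comes from exp(-1/64) >= 63/64 by six squarings, rounded down each time. *)
Lemma expR1_le : expR 1 <= 2743 / 1000 :> R.
Proof.
have e_gt0 : 0 < expR (- 1) :> R by apply: expR_gt0.
suff : (36 + 457 / 1000) / 100 <= expR (- 1) :> R.
  move=> h; have -> : 1 = - (- 1) :> R by rewrite opprK.
  by rewrite expRN -div1r ler_pdivrMr //; lra.
have sq (x a b : R) : 0 <= a -> a <= expR x -> b <= a * a -> b <= expR (x *+ 2).
  move=> a_ge0 le_a le_b; apply: le_trans le_b _.
  by rewrite mulr2n expRD ler_pM.
have h0 : 63 / 64 <= expR (- 1 / 64) :> R.
  by apply: le_trans (expR_ge1Dx _); lra.
have -> : - 1 = - 1 / 64 *+ 2 *+ 2 *+ 2 *+ 2 *+ 2 *+ 2 :> R by lra.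
apply: (@sq _ ((60 + 405 / 1000) / 100)); [lra | | lra].
apply: (@sq _ ((77 + 721 / 1000) / 100)); [lra | | lra].
apply: (@sq _ ((88 + 160 / 1000) / 100)); [lra | | lra].
apply: (@sq _ ((93 + 894 / 1000) / 100)); [lra | | lra].
apply: (@sq _ ((96 + 899 / 1000) / 100)); [lra | | lra].
by apply: sq h0 _; lra.
Qed.

(** d^d / d! is one term of the exponential series at d. *)
Lemma expX_fact_le (d : nat) : (0 < d)%N -> d%:R ^+ d <= expR 1 ^+ d * d`!%:R :> R.
Proof.
case: d => // d _; rewrite -expRM_natr mul1r.
have f_gt0 : 0 < (d.+1)`!%:R :> R by rewrite ltr0n fact_gt0.
rewrite -ler_pdivrMr //; apply: le_trans (expR_ge1Dxn d (ler0n _ _)).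
by rewrite lerDr.
Qed.

Lemma bin_mul_expX_le (m d : nat) : (0 < d)%N ->
  'C(m, d)%:R * d%:R ^+ d <= (expR 1 * m%:R) ^+ d :> R.
Proof.
move=> d_gt0; have := expX_fact_le d_gt0 => le_e.
apply: le_trans (ler_wpM2l (ler0n _ _) le_e) _.
rewrite exprMn mulrCA -natrM bin_ffact; apply: ler_wpM2l.
  by rewrite exprn_ge0 ?expR_ge0.
rewrite -natrX ler_nat; elim: d {d_gt0 le_e} => // d IHd.
by rewrite ffactnSr expnSr leq_mul // leq_subr.
Qed.

(** Combines C(r, d) / C(n, d) <= (r / n)^d with r y / n <= q. For y^d = N the left side counts the
    d-sets inside N sets of size r. *)
Lemma bin_scale_le (r n d : nat) (y q : R) : (0 < n)%N -> (r <= n)%N -> 0 <= y ->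
  r%:R * y <= q * n%:R -> y ^+ d * 'C(r, d)%:R <= q ^+ d * 'C(n, d)%:R.
Proof.
move=> n_gt0 le_rn y_ge0 le_q.
have n_gt0' : 0 < n%:R ^+ d :> R by rewrite exprn_gt0 // ltr0n.
rewrite -(ler_pM2r n_gt0').
have := bin_mul_expn_le d le_rn; rewrite -(ler_nat R) !natrM !natrX => le_bin.
have yd_ge0 : 0 <= y ^+ d by apply: exprn_ge0.
rewrite -mulrA; apply: le_trans (ler_wpM2l yd_ge0 le_bin) _.
rewrite mulrCA -exprMn [q ^+ d * _]mulrC -mulrA -exprMn.
have ry_ge0 : 0 <= r%:R * y by apply: mulr_ge0.
apply: ler_wpM2l => //; rewrite [y * _]mulrC.
by apply: lerXn2r; rewrite ?nnegrE ?(le_trans ry_ge0).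
Qed.

(* Weighting the k-th term by (d / r) ^ (d - k) <= 1 gives a binomial expansion
   of (1 + d / r) ^ r <= e ^ d. *)
Lemma sum_bin_le_expX (r d : nat) : (0 < d <= r)%N ->
  (\sum_(1 <= k < d.+1) 'C(r, k))%N%:R * d%:R ^+ d <= (expR 1 * r%:R) ^+ d :> R.
Proof.
case/andP=> d_gt0 le_dr.
have r_gt0 : 0 < r%:R :> R by rewrite ltr0n (leq_trans d_gt0).
pose t : R := d%:R / r%:R.
have t_ge0 : 0 <= t by rewrite divr_ge0.
have t_le1 : t <= 1 by rewrite ler_pdivrMr // mul1r ler_nat.
have -> : d%:R = t * r%:R by rewrite /t divfK ?gt_eqF.
rewrite [(t * _) ^+ d]exprMn [(expR 1 * _) ^+ d]exprMn mulrA ler_pM2r ?exprn_gt0 //.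
apply: (@le_trans _ _ ((t + 1) ^+ r)); last first.
  apply: (@le_trans _ _ (expR t ^+ r)).
    apply: lerXn2r; rewrite ?nnegrE ?expR_ge0 ?addr_ge0 //.
    by rewrite addrC expR_ge1Dx.
  by rewrite -!expRM_natr /t divfK ?gt_eqF // mul1r.
rewrite exprD1n -(big_mkord predT (fun i => t ^+ i *+ 'C(r, i))).
rewrite [leRHS](@big_cat_nat _ _ _ 1) //= (@big_cat_nat _ _ _ d.+1 1 r.+1) //=.
rewrite natr_sum mulr_suml addrCA -[X in X <= _]addr0; apply: lerD.
  apply: ler_sum_nat => k /andP[_ le_kd].
  by rewrite -[leRHS]mulr_natl ler_wpM2l // ler_wiXn2l.
by rewrite addr_ge0 // sumr_ge0 // => k _; rewrite mulrn_wge0 // exprn_ge0.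
Qed.

Variables (n d N : nat).
Hypotheses (n_gt0 : (0 < n)%N) (d_gt0 : (0 < d)%N).
Variable y : R.
Hypotheses (y_gt0 : 0 < y) (y_pow : y ^+ d = N%:R).

(** The share is at most 2^-d <= 1/2, which is below 11/12. *)
Lemma cover_unif (r : nat) : (r <= n)%N -> 2 * r%:R * y < n%:R ->
  12 * (N * 'C(r, d))%N%:R <= 11 * 'C(n, d)%:R :> R.
Proof.
move=> le_rn lt_n; have le_h : r%:R * y <= 1 / 2 * n%:R by lra.
have := bin_scale_le d n_gt0 le_rn (ltW y_gt0) le_h; rewrite y_pow natrM => le_N.
have : (1 / 2) ^+ d <= 1 / 2 :> R.
  by rewrite -[leRHS]expr1; apply: ler_wiXn2l => //; lra.
have := ler0n R 'C(n, d).
nra.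
Qed.

(** Here the sum is at most 2^(d - 1), while 2 T <= n makes N at most 2^-d C(n, d); the product is
    at most half of C(n, d). *)
Lemma cover_nonunif_small (r T : nat) : (N <= 'C(T, d))%N -> (T.*2 <= n)%N ->
  (r < d)%N ->
  12 * (N * \sum_(1 <= k < d.+1) 'C(r, k))%N%:R <= 11 * 'C(n, d)%:R :> R.
Proof.
move=> leN leT lt_rd.
have le_Tn : (T <= n)%N by lia.
have le_h : T%:R * 2 <= 1 * n%:R :> R by rewrite mul1r -natrM ler_nat muln2.
have := bin_scale_le d n_gt0 le_Tn (ler0n _ 2) le_h; rewrite expr1n mul1r => le_C.
have le_2 : (2 * \sum_(1 <= k < d.+1) 'C(r, k) <= 2 ^ d)%N.
  rewrite -(prednK d_gt0) expnS leq_mul2l /=.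
  apply: leq_trans (sum_bin_le_exp2 NonUniform r _) _.
  by rewrite leq_exp2l //; lia.
have : (2 * (N * \sum_(1 <= k < d.+1) 'C(r, k)) <= 'C(n, d))%N.
  rewrite mulnCA; apply: leq_trans (leq_mul leN le_2) _.
  by rewrite -(ler_nat R) natrM natrX mulrC.
rewrite -(ler_nat R) natrM => h; have := ler0n R 'C(n, d); lra.
Qed.

(** With h = 2 sqrt 2, [sum_bin_le_expX] and r y < n / h bound N times the sum by (e / h)^d (n /
    d)^d, and (n / d)^d <= C(n, d). *)
Lemma cover_nonunif_large (r : nat) : (d <= n)%N -> (d <= r <= n)%N ->
  2 * Num.sqrt 2 * r%:R * y < n%:R ->
  12 * (N * \sum_(1 <= k < d.+1) 'C(r, k))%N%:R <= 11 * 'C(n, d)%:R :> R.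
Proof.
move=> le_dn /andP[le_dr le_rn].
have [h h_def] : exists h : R, h = 2 * Num.sqrt 2 by exists (2 * Num.sqrt 2).
rewrite -h_def => lt_n.
have sq2 : Num.sqrt 2 ^+ 2 = 2 :> R by rewrite sqr_sqrtr.
have sq_ge0 : 0 <= Num.sqrt 2 :> R by apply: sqrtr_ge0.
have sq_ge : 1414 / 1000 <= Num.sqrt 2 :> R by nra.
have h_gt0 : 0 < h by rewrite h_def; lra.
have := bin_mul_expn_le d le_dn; rewrite binn mul1n -(ler_nat R) natrM !natrX => le_C.
have C_ge0 := ler0n R 'C(n, d).
set S := (\sum_(1 <= k < d.+1) 'C(r, k))%N; rewrite natrM -y_pow.
have ry : (r%:R * y) ^+ d * h ^+ d <= n%:R ^+ d.
  rewrite -exprMn; apply: lerXn2r; rewrite ?nnegrE ?mulr_ge0 //;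
    try exact: ltW.
  by rewrite mulrC mulrA ltW.
(* The general bound (e / (2 sqrt 2)) ^ d is too weak for d <= 2. *)
have [d_le2|d_gt2] := leqP d 2.
  (* This bound gives the share (d / h)^d, that is 1 / h or 1/2. *)
  have leS : (S <= r ^ d)%N.
    rewrite /S; case: (d) d_gt0 d_le2 le_dr => [|[|[|]]] // _ _ le_dr'.
      by rewrite big_nat1 bin1 expn1.
    rewrite big_nat_recr //= big_nat1 bin1 bin2; lia.
  have leS' : S%:R * y ^+ d * h ^+ d <= 'C(n, d)%:R * d%:R ^+ d.
    apply: le_trans le_C; apply: le_trans ry; rewrite exprMn -(natrX _ r).
    rewrite ler_wpM2r ?exprn_ge0 ?(ltW h_gt0) //.
    by rewrite ler_wpM2r ?exprn_ge0 ?(ltW y_gt0) // ler_nat.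
  have z_ge0 : 0 <= S%:R * y ^+ d.
    by rewrite mulr_ge0 ?ler0n ?exprn_ge0 ?(ltW y_gt0).
  case: (d) d_gt0 d_le2 leS' C_ge0 z_ge0 => [|[|[|]]] // _ _;
    rewrite ?expr1 h_def; nra.
have leS : S%:R * d%:R ^+ d <= (expR 1 * r%:R) ^+ d :> R.
  by apply: sum_bin_le_expX; rewrite d_gt0.
pose q : R := expR 1 / h.
have q_ge0 : 0 <= q by rewrite divr_ge0 ?expR_ge0 ?(ltW h_gt0).
have q_le : q <= 97 / 100.
  by rewrite ler_pdivrMr //; have := expR1_le; rewrite h_def; lra.
have qd_le : q ^+ d <= 11 / 12.
  (* The exponent 3 is the first for which (97/100)^d is at most 11/12. *)
  apply: (@le_trans _ _ (q ^+ 3)); first by apply: ler_wiXn2l => //; lra.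
  have q2 : q * q <= 97 / 100 * (97 / 100) by rewrite ler_pM.
  rewrite exprS expr2.
  apply: (@le_trans _ _ (97 / 100 * (97 / 100 * (97 / 100)))); last by lra.
  by rewrite ler_pM // mulr_ge0.
have main : y ^+ d * S%:R * d%:R ^+ d <= q ^+ d * 'C(n, d)%:R * d%:R ^+ d.
  have := ler_wpM2l (exprn_ge0 d (ltW y_gt0)) leS; rewrite mulrA => h1.
  apply: le_trans h1 _; have e_qh : expR 1 = q * h by rewrite /q divfK ?gt_eqF.
  have -> : y ^+ d * (expR 1 * r%:R) ^+ d = q ^+ d * ((r%:R * y) ^+ d * h ^+ d).
    by rewrite -!exprMn; congr (_ ^+ _); rewrite e_qh; ring.
  rewrite -mulrA; apply: ler_wpM2l; first exact: exprn_ge0.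
  exact: le_trans ry le_C.
have dd_gt0 : 0 < d%:R ^+ d :> R by rewrite exprn_gt0 // ltr0n.
rewrite ler_pM2r // in main; nra.
Qed.

End CoverNumerics.

(** * Deterministic bounds *)

Section RatioBound.
Local Open Scope nat_scope.

(** C(., d) increases strictly above d, so f > T would force C(f, d) > C(T, d) >= N. *)
Lemma ic_f_le (d N T : nat) : 0 < d -> 0 < N -> N <= 'C(T, d) -> ic_f d N <= T.
Proof.
move=> d_gt0 N_gt0 leN; rewrite leqNgt; apply/negP => lt_Tf.
have le_dT : d <= T by rewrite -bin_gt0 (leq_trans N_gt0).
have := leq_trans (leq_trans (leq_bin2l d lt_Tf) (bin_ic_f_le N d_gt0)) leN.
rewrite -[X in 'C(_, X)](prednK d_gt0) binS (prednK d_gt0).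
have : 0 < 'C(T, d.-1) by rewrite bin_gt0; lia.
lia.
Qed.

(** If f divides n, no vertex is left over. Otherwise n = q (f + d) + r and s = q + 1 leave fewer
    than d (q + 1) vertices, no more than d families hold; then q + 1 <= 2 q and q (f + 1) <= n
    conclude. *)
Lemma ic_size_le (n d N : nat) : 0 < d -> 0 < N -> ic_f d N + d <= n ->
  (d * ic_s n d N + (n - ic_f d N * ic_s n d N)) * (ic_f d N).+1 <= 4 * n * d.
Proof.
move=> d_gt0 N_gt0 le_fdn; have le_df := ic_f_ge d_gt0 N_gt0.
rewrite /ic_s; set f := ic_f d N in le_fdn le_df *.
have f_gt0 : 0 < f by apply: leq_trans le_df.
case: ifP => [f_dvd|_].
  have n_eq := divnK f_dvd; set s := n %/ f in n_eq *.
  have -> : n - f * s = 0 by rewrite mulnC n_eq subnn.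
  have h : d * s * f.+1 <= d * s * (2 * f).
    by apply: leq_mul => //; move: f_gt0; clear; lia.
  by rewrite -n_eq; nia.
have n_eq := divn_eq n (f + d).
have lt_r : n %% (f + d) < f + d by rewrite ltn_mod addn_gt0 f_gt0.
set q := n %/ (f + d) in n_eq *; set r := n %% (f + d) in n_eq lt_r.
have q_gt0 : 0 < q by rewrite divn_gt0 // addn_gt0 f_gt0.
have h1 : d * q.+1 + (n - f * q.+1) <= 2 * (d * q.+1) by nia.
have h2 : 2 * (d * q.+1) <= 4 * (d * q) by nia.
apply: leq_trans (leq_mul (leq_trans h1 h2) (_ : f.+1 <= f + d)) _; first by lia.
by nia.
Qed.

End RatioBound.

Section RealParameters.
Variables (R : realType) (n d N : nat).
Hypotheses (n_gt0 : (0 < n)%N) (d_gt0 : (0 < d)%N) (N_gt0 : (0 < N)%N).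
Hypothesis d_le : d%:R <= n%:R / 2 :> R.
Let T := Num.truncn (Num.sqrt (n%:R * d%:R / 2 : R)).
Hypothesis N_le : (N <= 'C(T, d))%N.

(** As d <= n / 2, the number n d / 2 is at most (n / 2)^2. *)
Lemma double_truncn_le : (T.*2 <= n)%N.
Proof.
have nd_ge0 : 0 <= n%:R * d%:R / 2 :> R by rewrite divr_ge0 // mulr_ge0.
have T_le : T%:R <= Num.sqrt (n%:R * d%:R / 2) :> R by rewrite truncn_le sqrtr_ge0.
have n_ge0 := ler0n R n; have d_ge0 := ler0n R d.
rewrite -muln2 -(ler_nat R) natrM -ler_pdivlMr //; apply: le_trans T_le _.
have half_ge0 : 0 <= n%:R / 2 :> R by lra.
rewrite -[leRHS](ger0_norm half_ge0) -sqrtr_sqr ler_wsqrtr //.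
by have := ler_wpM2l n_ge0 d_le; rewrite expr2; lra.
Qed.

Let y : R := N%:R `^ (1 / d%:R).

Lemma root_gt0 : 0 < y.
Proof. by rewrite powR_gt0 // ltr0n. Qed.

Lemma root_pow : y ^+ d = N%:R.
Proof.
rewrite -powR_mulrn ?powR_ge0 // /y -powRrM div1r mulVf ?powRr1 //.
by rewrite pnatr_eq0 -lt0n.
Qed.

Lemma root_ge1 : 1 <= y.
Proof.
rewrite leNgt; apply/negP => lt1.
have : y ^+ d < 1 by rewrite exprn_ilt1 ?(ltW root_gt0) // -lt0n.
by rewrite root_pow ltNge ler1n N_gt0.
Qed.

Lemma ic_f_add_le : (ic_f d N + d <= n)%N.
Proof.
have le_fT := ic_f_le d_gt0 N_gt0 N_le; have := double_truncn_le.
have : (d.*2 <= n)%N.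
  by rewrite -muln2 -(ler_nat R) natrM -ler_pdivlMr.
lia.
Qed.

Lemma root_le_ic_f : y * d%:R <= expR 1 * (ic_f d N).+1%:R.
Proof.
rewrite -(ler_pXn2r d_gt0) ?nnegrE ?mulr_ge0 ?expR_ge0 ?(ltW root_gt0) //.
apply: le_trans (bin_mul_expX_le R _ d_gt0); rewrite exprMn root_pow.
apply: ler_wpM2r; first exact: exprn_ge0.
by rewrite ler_nat ltnW // ltnNge ic_fP // ltnn.
Qed.

Lemma pi_IC_root_le (c : edge_case) (X : {set {set 'I_n}}) :
  (pi_IC d N c X)%:R * y <= 4 * expR 1 * n%:R.
Proof.
have := ic_size_le d_gt0 N_gt0 ic_f_add_le.
have := pi_IC_le c X d_gt0 N_gt0 => le1 le2.
have : (pi_IC d N c X * (ic_f d N).+1 <= 4 * n * d)%N.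
  by apply: leq_trans le2; rewrite leq_mul2r le1 orbT.
rewrite -(ler_nat R) !natrM => le_pi.
have d_gt0' : 0 < d%:R :> R by rewrite ltr0n.
have f_gt0 : 0 < (ic_f d N).+1%:R :> R by rewrite ltr0n.
have le_y := root_le_ic_f.
(* After multiplication by d (f + 1), the bounds pi (f + 1) <= 4 n d and y d <= e (f + 1) chain and
   f cancels. *)
rewrite -(ler_pM2r d_gt0') -(ler_pM2r f_gt0).
set p := (pi_IC d N c X)%:R in le_pi *.
set f := (ic_f d N).+1%:R in le_pi f_gt0 le_y *.
have p_ge0 : 0 <= p by apply: ler0n.
have := ler_wpM2r (_ : 0 <= y * d%:R) le_pi; rewrite mulr_ge0 ?(ltW root_gt0) //.
move=> /(_ isT) h1.
have : 0 <= 4 * n%:R * d%:R :> R by rewrite !mulr_ge0.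
move=> /ler_wpM2l /(_ _ _ le_y) h2.
by apply: le_trans (le_trans _ h1) (le_trans h2 _); rewrite le_eqVlt;
  apply/predU1l; ring.
Qed.

Lemma pi_ratio_le (c : edge_case) (X : {set {set 'I_n}}) :
  (pi_IC d N c X)%:R / pi_LB R c n d N <= ratio_bound R c.
Proof.
have y_gt0 := root_gt0; have n_gt0' : 0 < n%:R :> R by rewrite ltr0n.
have sq_gt0 : 0 < Num.sqrt 2 :> R by rewrite sqrtr_gt0.
have le_pi := pi_IC_root_le c X.
have ny_gt0 : 0 < n%:R / y by rewrite divr_gt0.
(* [k] is 2 or 2 sqrt 2: the lower bound is n / (k y), so the ratio is at most 4 k e. *)
suff [k k_gt0 [-> ->]] : exists2 k : R, 0 < k &
    pi_LB R c n d N = 1 / k * (n%:R / y) /\ ratio_bound R c = 4 * k * expR 1.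
  rewrite ler_pdivrMr; last by rewrite mulr_gt0 // div1r invr_gt0.
  have -> : 4 * k * expR 1 * (1 / k * (n%:R / y)) = 4 * expR 1 * n%:R / y.
    by field; rewrite ?gt_eqF.
  by rewrite ler_pdivlMr.
case: (c) => /=; [exists 2 | exists (2 * Num.sqrt 2)] => //; rewrite ?mulr_gt0 //.
  by split => //; ring.
by split => //; ring.
Qed.

(** The comparison is with C(n, d), which is at most the number of edges. Non-uniform sets of fewer
    than [d] vertices are treated apart, since (e r / d)^d bounds the sum only for d <= r. *)
Lemma card_edges_in_small (c : edge_case) (S : {set 'I_n}) : (1 < N)%N ->
  #|S|%:R < pi_LB R c n d N ->
  (12 * (N * #|[set e in all_edges c n d | e \subset S]|)
     <= 11 * #|all_edges c n d|)%N.
Proof.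
move=> N_gt1 lt_S; rewrite card_edges_in card_all_edges.
have le_Sn : (#|S| <= n)%N by rewrite -[leqRHS]card_ord max_card.
have le_dn : (d <= n)%N by have := ic_f_add_le; lia.
have y_gt0 := root_gt0.
apply: (@leq_trans (11 * 'C(n, d))); last by rewrite leq_mul2l bin_le_sum.
rewrite -(ler_nat R) natrM [leRHS]natrM.
have sq_gt0 : 0 < Num.sqrt 2 :> R by rewrite sqrtr_gt0.
have small (k : R) : 0 < k ->
    #|S|%:R < 1 / k * (n%:R / y) -> k * #|S|%:R * y < n%:R.
  move=> k_gt0; rewrite mulrA ltr_pdivlMr // mul1r.
  by rewrite [k^-1 * _]mulrC ltr_pdivlMr // mulrC mulrA.
case: c lt_S => /small lt_S; rewrite /min_size.
  rewrite big_nat1; apply: cover_unif root_pow _ _ _ => //; exact: lt_S.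
have [le_dS|lt_Sd] := leqP d #|S|.
  apply: cover_nonunif_large root_pow _ _ _ _ => //; rewrite ?le_dS //.
  by apply: lt_S; rewrite mulr_gt0.
by apply: cover_nonunif_small N_le double_truncn_le _.
Qed.

(** Required because [pi_star] is a minimum with default value [n]. *)
Lemma pi_LB_le (c : edge_case) : pi_LB R c n d N <= n%:R.
Proof.
have y_ge1 := root_ge1; have n_ge0 := ler0n R n; have sq_ge0 := sqrtr_ge0 (2 : R).
have sq2 : Num.sqrt 2 ^+ 2 = 2 :> R by rewrite sqr_sqrtr.
have sq_ge1 : 1 <= Num.sqrt 2 :> R by nra.
have le_n : n%:R / y <= n%:R.
  by rewrite ler_pdivrMr ?root_gt0 // ler_peMr.
have ny_ge0 : 0 <= n%:R / y by rewrite divr_ge0 // ltW ?root_gt0.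
case: c => /=; rewrite -/y; first by lra.
apply: le_trans le_n; rewrite ler_piMl // ler_pdivrMr; lra.
Qed.

End RealParameters.

Lemma pi_star_ge (R : realType) (n N : nat) (X : {set {set 'I_n}}) (r : R) :
  r <= n%:R ->
  (forall Phi : {ffun 'I_N -> {set {set 'I_n}}}, edge_partitioning Phi X ->
     r <= (max_footprint Phi)%:R) ->
  r <= (pi_star N X)%:R.
Proof.
move=> le_rn le_r; rewrite /pi_star; elim/big_ind: _ => //.
by move=> a b le_a le_b; rewrite /minn; case: ifP.
Qed.

Definition covered (c : edge_case) (n d N : nat)
    (S : {ffun 'I_N -> {set 'I_n}}) : {set {set 'I_n}} :=
  \bigcup_b [set e in all_edges c n d | e \subset S b].

Lemma covered_small_partition (R : realType) (c : edge_case) (n d N : nat)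
    (X : {set {set 'I_n}}) (r : R) :
  r <= n%:R -> X \subset all_edges c n d -> (pi_star N X)%:R < r ->
  exists2 S : {ffun 'I_N -> {set 'I_n}},
    [forall b, #|S b|%:R < r] & X \subset covered c d S.
Proof.
move=> le_rn sXA lt_r.
have /existsP[Phi /andP[/andP[_ /eqP cov] lt_Phi]] :
    [exists Phi : {ffun 'I_N -> {set {set 'I_n}}},
       edge_partitioning Phi X && ((max_footprint Phi)%:R < r)].
  apply: contraTT lt_r => /existsPn noPhi; rewrite -leNgt.
  apply: pi_star_ge => // Phi Phi_part; rewrite leNgt.
  by have := noPhi Phi; rewrite Phi_part.
(* The footprints serve as vertex sets: every edge lies inside the footprint of its group. *)
exists [ffun b => footprint (Phi b)].
  apply/forallP => b; rewrite ffunE; apply: le_lt_trans lt_Phi.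
  by rewrite ler_nat (@leq_bigmax _ (fun b => #|footprint (Phi b)|)).
apply/subsetP => e eX; have := eX; rewrite -cov => /bigcupP[b _ eb].
apply/bigcupP; exists b => //; rewrite inE (subsetP sXA) //= ffunE.
by apply/subsetP => i ie; rewrite inE; apply/existsP; exists e; rewrite eb.
Qed.

Lemma card_uncovered (R : realType) (c : edge_case) (n d N : nat)
    (n_gt0 : (0 < n)%N) (d_gt0 : (0 < d)%N) (N_gt1 : (1 < N)%N)
    (d_le : d%:R <= n%:R / 2 :> R)
    (N_le : (N <= 'C(Num.truncn (Num.sqrt (n%:R * d%:R / 2 : R)), d))%N)
    (S : {ffun 'I_N -> {set 'I_n}}) :
  [forall b, #|S b|%:R < pi_LB R c n d N] ->
  (#|all_edges c n d| <= 12 * #|all_edges c n d :\: covered c d S|)%N.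
Proof.
move/forallP=> small; set A := all_edges c n d; have N_gt0 := ltnW N_gt1.
have sYA : covered c d S \subset A.
  by apply/bigcupsP => b _; apply/subsetP => e; rewrite inE => /andP[].
have cardY : (#|covered c d S| <= \sum_b #|[set e in A | e \subset S b]|)%N.
  rewrite /covered; elim/big_rec2: _ => [|b U V _ IH]; first by rewrite cards0.
  by apply: leq_trans (leq_card_setU _ _) _; rewrite leq_add2l.
have : (12 * N * #|covered c d S| <= 11 * N * #|A|)%N.
  apply: leq_trans (leq_mul (leqnn _) cardY) _; rewrite big_distrr /=.
  apply: (@leq_trans (\sum_(b < N) 11 * #|A|)).
    apply: leq_sum => b _; rewrite -mulnA.
    exact: card_edges_in_small n_gt0 d_gt0 N_gt0 d_le N_le _ _ N_gt1 (small b).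
  by rewrite sum_nat_const card_ord mulnA [(N * 11)%N]mulnC.
rewrite [(12 * N)%N]mulnC [(11 * N)%N]mulnC -!mulnA leq_mul2l eqn0Ngt N_gt0 /=.
rewrite cardsD (setIidPr sYA); move: (subset_leq_card sYA).
by move: #|covered c d S| #|A| => a b; lia.
Qed.

(** Merges the two cases into one constant [M]. As 15/12 * 4/5 and 13/12 * 12/13 both equal 1, M /
    12 contains N ln(2 n^z) exactly, and n N ln N with a factor at least 1. *)
Lemma threshold_exists (R : realType) (c : edge_case) (n d N : nat) (z : R) :
  (0 < n)%N -> (0 < N)%N ->
  exists M : R, [/\ phi_min c n d N z = Num.min (M / #|all_edges c n d|%:R) 1,
    forall X : {set {set 'I_n}}, many_edges c N z X = (M / 2 <= #|X|%:R) &
    n%:R * N%:R * ln N%:R + N%:R * ln (2 * n%:R `^ z) <= M / 12].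
Proof.
move=> n_gt0 N_gt0; rewrite card_all_edges.
have n_gt0' : 0 < n%:R :> R by rewrite ltr0n.
have lnN_ge0 : 0 <= ln N%:R :> R by rewrite ln_ge0 // ler1n.
have nN_ge0 : 0 <= n%:R * N%:R :> R by rewrite mulr_ge0.
have prod_ge0 : 0 <= n%:R * N%:R * ln N%:R :> R by apply: mulr_ge0.
set L := ln (2 * _).
have cancel_n : n%:R * N%:R * (L / n%:R) = N%:R * L by field; rewrite gt_eqF.
case: c => /=.
- exists (15 * n%:R * N%:R * (ln N%:R + 4 / 5 * (L / n%:R))); split=> [|X|].
  + by rewrite big_nat1.
  + by congr (_ <= _); rewrite /L; field; rewrite gt_eqF.
  + rewrite -cancel_n; lra.
- exists (13 * n%:R * N%:R * (ln N%:R + 12 / 13 * (L / n%:R))); split=> [//|X|].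
  + by congr (_ <= _); rewrite /L; field; rewrite gt_eqF.
  + rewrite -cancel_n; lra.
Qed.

(** * The probabilistic lower bound *)

(** The free bound [q] serves both branches of [phi_min]: it is 0 when the minimum is 1, and exp(- M
    / 12) otherwise. *)
Lemma Pr_small_pi_star (R : realType) (c : edge_case) (n d N : nat)
    (phi : {set 'I_n} -> R)
    (n_gt0 : (0 < n)%N) (d_gt0 : (0 < d)%N) (N_gt1 : (1 < N)%N)
    (d_le : d%:R <= n%:R / 2 :> R)
    (N_le : (N <= 'C(Num.truncn (Num.sqrt (n%:R * d%:R / 2 : R)), d))%N) (q : R) :
  (forall e, e \in all_edges c n d -> 0 <= phi e <= 1) ->
  (forall Y, (#|all_edges c n d| <= 12 * #|all_edges c n d :\: Y|)%N ->
     \prod_(e in all_edges c n d :\: Y) (1 - phi e) <= q) ->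
  Pr (all_edges c n d) phi [pred X | ~~ (pi_LB R c n d N <= (pi_star N X)%:R)] <=
    2 ^+ (n * N) * q.
Proof.
move=> phi_range prod_le; set A := all_edges c n d.
pose small (S : {ffun 'I_N -> {set 'I_n}}) := [forall b, #|S b|%:R < pi_LB R c n d N].
have q_ge0 : 0 <= q.
  apply: le_trans (prod_le set0 _); last by rewrite setD0 leq_pmull.
  by apply: prodr_ge0 => e /setDP[/phi_range/andP[_]]; rewrite subr_ge0.
apply: le_trans (Pr_union phi_range (P := small)
  (F := fun S => [pred X : {set {set 'I_n}} | X \subset covered c d S]) _) _.
  move=> X sXA /=; rewrite -ltNge => lt_pi.
  by apply: covered_small_partition sXA lt_pi; apply: pi_LB_le => //; apply: ltnW.
apply: (@le_trans _ _ (\sum_(S | small S) q)).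
  apply: ler_sum => S small_S; apply: le_trans (Pr_subset_le phi_range _) _.
  exact: prod_le (card_uncovered n_gt0 d_gt0 N_gt1 d_le N_le small_S).
(* There are (2^n)^N choices of the [N] vertex sets. *)
rewrite sumr_const -[leLHS]mulr_natl; apply: ler_wpM2r => //.
rewrite -natrX ler_nat; apply: leq_trans (max_card _) _.
rewrite card_ffun card_ord expnM leq_exp2r ?(ltnW N_gt1) //.
by rewrite -cardsT -powersetT card_powerset cardsT card_ord.
Qed.

Theorem corollary1 (R : realType) (c : edge_case) (n d N : nat) (z : R)
    (phi : {set 'I_n} -> R)
    (n_gt0 : (0 < n)%N) (d_gt0 : (0 < d)%N) (N_gt0 : (0 < N)%N)
    (d_le : d%:R <= n%:R / 2 :> R)
    (N_le : (N <= 'C(Num.truncn (Num.sqrt (n%:R * d%:R / 2 : R)), d))%N)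
    (z_ge1 : 1 <= z)
    (phi_range : forall e, e \in all_edges c n d ->
                   phi_min c n d N z <= phi e <= 1)
    (U_pos : 0 < Pr (all_edges c n d) phi (many_edges c N z)) :
  ((1 < N)%N ->
     1 - 2 / (3 * n%:R `^ z) <=
       cond_Pr (all_edges c n d) phi
         (fun X => pi_LB R c n d N <= (pi_star N X)%:R <= ((pi_IC d N c X)%:R : R))
         (many_edges c N z))
  /\ (forall X : {set {set 'I_n}}, X \subset all_edges c n d ->
        (pi_IC d N c X)%:R / pi_LB R c n d N <= ratio_bound R c).
Proof.
split=> [N_gt1|X _]; last exact: pi_ratio_le.
have [M [phi_minE manyE le_M]] := threshold_exists c d z n_gt0 N_gt0.
set A := all_edges c n d in phi_range U_pos phi_minE *.
have A_gt0 : 0 < #|A|%:R :> R.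
  rewrite ltr0n card_all_edges (leq_trans _ (bin_le_sum c n d_gt0)) // bin_gt0.
  by have := ic_f_add_le n_gt0 d_gt0 N_gt0 d_le N_le; lia.
have u_ge1 : 1 <= n%:R `^ z.
  by rewrite -[leLHS](powRr0 (n%:R : R)) ler_powR ?ler1n // (le_trans ler01).
set u := n%:R `^ z in le_M u_ge1 *.
have lnN_ge0 : 0 <= ln N%:R :> R by rewrite ln_ge0 // ler1n.
have L_ge0 : 0 <= ln (2 * u) by rewrite ln_ge0 //; lra.
have N_ge2 : 2 <= N%:R :> R by rewrite (ler_nat _ 2).
have M_ge0 : 0 <= M.
  have h1 : 0 <= n%:R * N%:R * ln N%:R :> R by rewrite !mulr_ge0.
  have h2 : 0 <= N%:R * ln (2 * u) by rewrite mulr_ge0.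
  lra.
have phi_ge e : e \in A -> phi_min c n d N z <= phi e by move=> /phi_range/andP[].
have phi_range0 e : e \in A -> 0 <= phi e <= 1.
  move=> eA; have /andP[ge_phi ->] := phi_range e eA; rewrite andbT.
  by apply: le_trans ge_phi; rewrite phi_minE le_min ler01 divr_ge0 ?(ltW A_gt0).
apply: cond_Pr_ge => //.
have sub_bad : Pr A phi [pred X | ~~ (pi_LB R c n d N <= (pi_star N X)%:R
      <= ((pi_IC d N c X)%:R : R))] <=
    Pr A phi [pred X | ~~ (pi_LB R c n d N <= (pi_star N X)%:R)].
  apply: Pr_mono => // X sXA /=; apply: contra => ->.
  by rewrite ler_nat pi_star_le_IC.
apply: le_trans sub_bad _.
have bad_le := Pr_small_pi_star n_gt0 d_gt0 N_gt1 d_le N_le phi_range0.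
(* If the minimum is 1, every phi is 1, and a single edge outside [Y] makes the product vanish. *)
have [phi_min1|M_lt] := leP 1 (M / #|A|%:R).
  have phi1 e : e \in A -> phi e = 1.
    move=> eA; have := phi_range e eA; rewrite phi_minE min_r // => h.
    by apply/eqP; rewrite eq_le andbC.
  apply: (@le_trans _ _ 0); last first.
    by rewrite mulr_ge0 ?divr_ge0 ?(ltW U_pos) //; lra.
  rewrite -[leRHS](mulr0 (2 ^+ (n * N))); apply: bad_le => Y cardY.
  have /card_gt0P[e eAY] : (0 < #|A :\: Y|)%N.
    have := A_gt0; rewrite ltr0n; move: cardY; rewrite -/A.
    by move: #|A :\: Y| #|A| => a b; lia.
  have eA : e \in A by case/setDP: eAY.
  by rewrite (bigD1 e) //= phi1 // subrr mul0r.
have pE : phi_min c n d N z * #|A|%:R = M.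
  by rewrite phi_minE min_l ?ltW // divfK ?gt_eqF.
have p_le1 : phi_min c n d N z <= 1 by rewrite phi_minE ge_min lexx orbT.
have p_ge0 : 0 <= phi_min c n d N z.
  by rewrite phi_minE le_min ler01 divr_ge0 ?(ltW A_gt0).
have exp2L : expR (- (2 * ln (2 * u))) = (2 * u)^-1 * (2 * u)^-1.
  rewrite mulrDl mul1r opprD expRD expRN lnK // posrE; lra.
(* [N >= 2] yields twice the logarithm, hence the square of 1 / (2 u) below. *)
have le_2L : 2 * ln (2 * u) <= M / 12 - n%:R * N%:R * ln N%:R.
  have : 2 * ln (2 * u) <= N%:R * ln (2 * u) by apply: ler_wpM2r.
  lra.
have bad_small : Pr A phi [pred X | ~~ (pi_LB R c n d N <= (pi_star N X)%:R)]
    <= (2 * u)^-1 * (2 * u)^-1.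
  apply: le_trans (bad_le (expR (- (M / 12))) _) _ => [Y cardY|].
    apply: le_trans (@expR_ge_prod1B _ _ _ phi (phi_min c n d N z) _) _.
      by move=> e /setDP[/phi_range].
    rewrite ler_expR -/A lerN2 -pE -mulrA ler_wpM2l //.
    by rewrite ler_pdivrMr // -natrM ler_nat mulnC.
  rewrite -exp2L.
  (* As [N >= 2], the 2^(n N) choices are at most N^(n N) = exp(n N ln N), which M / 12 absorbs. *)
  apply: (@le_trans _ _ (expR (n%:R * N%:R * ln N%:R) * expR (- (M / 12)))).
    apply: ler_wpM2r; first exact: expR_ge0.
    rewrite mulrC -natrM expRM_natr lnK ?posrE ?ltr0n //.
    by apply: lerXn2r; rewrite ?nnegrE.
  by rewrite -expRD ler_expR; lra.
have notU_small : Pr A phi [pred X | ~~ many_edges c N z X]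
    <= (2 * u)^-1 * (2 * u)^-1.
  have le_mM : M <= phi_min c n d N z * #|A|%:R by rewrite pE.
  apply: (@le_trans _ _ (expR (- (M / 12)))).
    apply: le_trans (Pr_few_le phi_range0 phi_ge le_mM p_le1).
    by apply: Pr_mono => // X _ /=; rewrite manyE ltNge.
  rewrite -exp2L ler_expR.
  have : 0 <= n%:R * N%:R * ln N%:R :> R by rewrite !mulr_ge0.
  lra.
have u_gt0 : 0 < u by lra.
have inv_u : (2 * u)^-1 * (2 * u)^-1 <= 1 / 2 * (2 * u)^-1.
  apply: ler_wpM2r; first by rewrite invr_ge0; lra.
  by rewrite div1r lef_pV2 ?posrE; lra.
have inv_le : (2 * u)^-1 <= 1 / 2 by rewrite div1r lef_pV2 ?posrE; lra.
(* As u >= 1, the complement has probability at most 1/4. *)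
have U_ge : 3 / 4 <= Pr A phi (many_edges c N z).
  rewrite (PrC A phi (many_edges c N z)).
  by set x := Pr _ _ _ in notU_small *; lra.
apply: le_trans bad_small _; apply: le_trans inv_u _.
(* 2 / (3 u) times 3/4 is 1 / (2 u), twice the bound just reached. *)
apply: (@le_trans _ _ (2 / (3 * u) * (3 / 4))).
  have -> : 2 / (3 * u) * (3 / 4) = (2 * u)^-1 by field; rewrite gt_eqF.
  have : 0 < (2 * u)^-1 by rewrite invr_gt0; lra.
  lra.
by apply: ler_wpM2l => //; rewrite divr_ge0 //; lra.
Qed.
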